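(* Let $\Sigma$ be a strict stratified extension of a Clifford semigroup $S$. Then $\Sigma$ is a semilattice of stratified extensions of groups.
   Context: For a semigroup $X$, $\mathrm{Base}(X)=\bigcap_{m>0}X^m$, where $X^m$ is the set of all products of $m$ elements of $X$. $X$ is a stratified extension of $\mathrm{Base}(X)$ if $\mathrm{Base}(X)\neq\emptyset$; so $X$ is a stratified extension of a group if $\mathrm{Base}(X)$ is a group. A Clifford semigroup is a completely regular inverse semigroup (equivalently, a semilattice of groups). A semigroup $\Sigma$ containing $S$ as an ideal is a strict extension of $S$ if for every $A\in\Sigma\setminus S$ there is $a\in S$ with $As=as$ and $sA=sa$ for all $s\in S$. $\Sigma$ is a strict stratified extension of the Clifford semigroup $S$ if $\Sigma$ is a strict extension of $S$ and $\mathrm{Base}(\Sigma)=S$ (equivalently, since $S$ is regular, $\Sigma$ is a strict extension of $S$ and the Rees quotient $T=\Sigma/S$ is a stratified semigroup, i.e. $\bigcap_{m>0}T^m=\{0\}$). $\Sigma$ is a semilattice of semigroups $\Sigma_\alpha$ ($\alpha\in Y$) if $Y$ is a semilattice (commutative semigroup of idempotents), $\Sigma$ is the disjoint union of its subsemigroups $\Sigma_\alpha$, and $\Sigma_\alpha\Sigma_\beta\subseteq\Sigma_{\alpha\beta}$ for all $\alpha,\beta\in Y$. *)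

(* Defs.v *)
From mathcomp Require Import all_boot.
From mathcomp Require Import boolp classical_sets.

Set Implicit Arguments.
Unset Strict Implicit.
Unset Printing Implicit Defensive.

Local Open Scope group_scope.
Local Open Scope classical_set_scope.

(* Semigroups live inside an ambient semigroup X: a semigroup is a subset of X
   closed under multiplication, and X itself is [set: X].  As usual in this
   setting the empty subset is not excluded from being a subsemigroup. *)
Section SubsetsOfSemigroup.
Variable X : semigroupType.
Implicit Types (A B G S I : set X) (x y e : X).

Definition subsemigroup A := forall x y, A x -> A y -> A (x * y).

Definition setprod A B : set X := [set x * y | x in A & y in B].

(* For m > 0 this is A * (A * ( ... * A)) with m factors; setpow A 0 is a junk
   value, which Base does not use. *)
Definition setpow A (m : nat) : set X := iterop m setprod A setT.

Definition Base A : set X := \bigcap_(m in [set m : nat | (0 < m)%N]) setpow A m.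

Definition subgroup G :=
  subsemigroup G /\
  exists2 e, G e &
    (forall x, G x -> e * x = x /\ x * e = x) /\
    (forall x, G x -> exists2 y, G y & x * y = e /\ y * x = e).

(* Union of groups: every element lies in a subgroup. *)
Definition completely_regular S :=
  forall x, S x -> exists2 G, subgroup G & G `<=` S /\ G x.

Definition inverse_semigroup S :=
  subsemigroup S /\
  forall x, S x -> exists! y, S y /\ (x * y * x = x /\ y * x * y = y).

Definition Clifford S := completely_regular S /\ inverse_semigroup S.

Definition ideal I := forall x y, I y -> I (x * y) /\ I (y * x).

Definition strict_extension S :=
  ideal S /\
  forall A : X, ~ S A ->
    exists2 a, S a & forall s, S s -> A * s = a * s /\ s * A = s * a.

Definition strict_stratified_extension S :=
  strict_extension S /\ Base [set: X] = S.

Definition stratified_extension_of_group A := subgroup (Base A).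

Definition semilattice (Y : semigroupType) :=
  (forall a b : Y, a * b = b * a) /\ (forall a : Y, a * a = a).

(* The ambient semigroup X is a semilattice of subsemigroups satisfying P. *)
Definition semilattice_of (P : set X -> Prop) :=
  exists (Y : semigroupType) (F : Y -> set X),
    semilattice Y /\
    (forall a, subsemigroup (F a) /\ P (F a)) /\
    trivIset [set: Y] F /\
    \bigcup_a F a = [set: X] /\
    (forall a b, setprod (F a) (F b) `<=` F (a * b)).

End SubsetsOfSemigroup.

Arguments semilattice_of : clear implicits.

(* Main.v *)
Require Import Defs.
From HB Require Import structures.
From mathcomp Require Import all_boot.
From mathcomp Require Import boolp classical_sets.

(** Every element [A] of [Sigma] multiplies elements of [S] exactly as some
    element [a] of [S] does: this is strictness outside [S], and trivial inside.
    A Clifford semigroup is weakly reductive, so [a] is unique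
    ([acts_like_uniq]); hence [A |-> a] is a retraction of [Sigma] onto [S], and
    it is a homomorphism because [S] is an ideal ([acts_like_mul]).  In [S],
    sending [a] to the identity of the subgroup containing it is a homomorphism
    onto the semilattice of idempotents, since idempotents of a Clifford
    semigroup are central ([idempotent_central], [group_unit_mul]).

    The composite [p] is therefore an idempotent endomorphism of [Sigma] with
    image the semilattice of idempotents of [S], and its fibres decompose
    [Sigma] ([semilattice_of_endomorphism]).  Let [F] be the fibre over an
    idempotent [e].  On one hand [Base F] lies in [Base Sigma = S] and in [F],
    that is, in the maximal subgroup of [S] with identity [e].  On the other
    hand this subgroup lies in [F] and equals each of its own powers, so it lies
    in [Base F].  Thus [Base F] is that group. *)

Set Implicit Arguments.
Unset Strict Implicit.
Unset Printing Implicit Defensive.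

Local Open Scope group_scope.
Local Open Scope classical_set_scope.

(** * Bases *)

Section Base.
Variable X : semigroupType.
Implicit Types A B : set X.

Lemma setprodSS A B A' B' :
  A `<=` A' -> B `<=` B' -> setprod A B `<=` setprod A' B'.
Proof. by move=> sA sB _ [x /sA Ax] [y /sB By] <-; exists x => //; exists y. Qed.

Lemma setpowSS A B m : A `<=` B -> setpow A m.+1 `<=` setpow B m.+1.
Proof. by move=> sAB; elim: m => //= m IH; apply: setprodSS. Qed.

Lemma BaseSS A B : A `<=` B -> Base A `<=` Base B.
Proof. by move=> sAB x bx [//|m] m0; apply: (setpowSS sAB); apply: bx. Qed.

Lemma Base_sub A : Base A `<=` A.
Proof. by move=> x /(_ 1%N); apply. Qed.

(** A set of products of its own elements can be factored repeatedly, hence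
    into any number of factors. *)
Lemma sub_Base A : A `<=` setprod A A -> A `<=` Base A.
Proof.
move=> sAA x Ax [//|m] _; elim: m x Ax => //= m IH x /sAA [y Ay] [z Az] <-.
by exists y => //; exists z => //; apply: IH.
Qed.

End Base.

(** * Semilattice decompositions from idempotent endomorphisms *)

(** The fixed points of [p] form the semilattice of indices; a subtype of [X]
    rather than all of [X] is needed because the fibres over other points are
    empty and may fail [P]. *)
Lemma semilattice_of_endomorphism (X : semigroupType) (P : set X -> Prop)
    (p : X -> X) :
  {morph p : x y / x * y} -> (forall x, p (p x) = p x) ->
  (forall x y, p x * p y = p y * p x) -> (forall x, p x * p x = p x) ->
  (forall x, P [set y | p y = p x]) ->
  semilattice_of X P.
Proof.
move=> pM pp pC pI pP.
pose T : choiceType := {x : X | p x == x}.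
have fixT (u : T) : p (val u) = val u by apply/eqP; case: u.
have fixM (u v : T) : p (val u * val v) == val u * val v by rewrite pM !fixT.
pose mulT (u v : T) : T := exist _ (val u * val v) (fixM u v).
have mulTA : associative mulT by move=> u v w; apply: val_inj; apply: mulgA.
pose Y : semigroupType := HB.pack T (isSemigroup.Build T mulTA).
exists Y, (fun u : T => [set x | p x = val u]).
split; first split.
- by move=> u v; apply: val_inj; rewrite /= -(fixT u) -(fixT v) pC.
- by move=> u; apply: val_inj; rewrite /= -(fixT u) pI.
split.
  move=> u; split; last by rewrite -(fixT u); apply: pP.
  by move=> x y /= xu yu; rewrite pM xu yu -(fixT u) pI.
split.
  by move=> u v _ _ [x [/= xu xv]]; apply: val_inj; exact: etrans (esym xu) xv.
split.
  rewrite eqEsubset; split=> // x _.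
  have fx : p (p x) == p x by rewrite pp.
  by exists (exist _ (p x) fx).
by move=> u v _ [x xu] [y yv] <- /=; rewrite pM xu yv.
Qed.

(** * Clifford semigroups *)

Section Clifford.
Variables (X : semigroupType) (S : set X).

(** [e] is the identity of a subgroup of [S] containing [a]. *)
Definition group_unit (a e : X) :=
  exists2 b, S b & [/\ a * b = e, b * a = e, e * a = a & e * b = b].

Lemma group_unit_idem a e : group_unit a e -> e * e = e.
Proof. by case=> b _ [ab _ ea _]; rewrite -{2}ab mulgA ea. Qed.

Lemma group_unitr a e : group_unit a e -> a * e = a.
Proof. by case=> b _ [ab ba ea _]; rewrite -ba mulgA ab. Qed.

Lemma group_unit_idempotent e : S e -> e * e = e -> group_unit e e.
Proof. by exists e. Qed.

Hypothesis hS : Clifford S.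

Lemma Clifford_mul x y : S x -> S y -> S (x * y).
Proof. by case: hS => _ [+ _]; apply. Qed.

Lemma group_unit_exists a : S a -> exists e, group_unit a e.
Proof.
case: hS => cr _ /cr [G [_ [e Ge [unit inv]]] [sGS Ga]].
have [b Gb [ab ba]] := inv a Ga.
by exists e, b; [apply: sGS | rewrite ab ba (unit a Ga).1 (unit b Gb).1].
Qed.

Lemma group_unit_in a e : S a -> group_unit a e -> S e.
Proof. by move=> Sa [b Sb [<- _ _ _]]; apply: Clifford_mul. Qed.

Lemma inverse_uniq a b c : S a -> S b -> S c ->
  a * b * a = a -> b * a * b = b -> a * c * a = a -> c * a * c = c -> b = c.
Proof.
case: hS => _ [_ inv] Sa Sb Sc aba bab aca cac.
by have [d [_ u]] := inv a Sa; rewrite -(u b) ?(u c).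
Qed.

Lemma group_unit_uniq a e f :
  S a -> group_unit a e -> group_unit a f -> e = f.
Proof.
move=> Sa [b Sb [ab ba ea eb]] [c Sc [ac ca fa fc]].
rewrite -ab -ac; congr (a * _).
by apply: (inverse_uniq Sa) => //; rewrite ?ab ?ba ?ac ?ca.
Qed.

(** Let [x] be the inverse of [e * f].  Then [f * x * e] is another inverse, so
    it equals [x], and this makes [x] idempotent.  Thus [x] and [e * f] are both
    inverses of [x], hence equal. *)
Lemma idempotent_mul e f :
  S e -> S f -> e * e = e -> f * f = f -> e * f * (e * f) = e * f.
Proof.
move=> Se Sf ee ff.
have Sef := Clifford_mul Se Sf.
case: (hS) => _ [_ inv]; have [x [[Sx [axa xax]] _]] := inv _ Sef.
have fxeE : f * x * e = x.
  apply: (inverse_uniq Sef) => //; first by do 2?apply: Clifford_mul.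
  - by rewrite -[RHS]axa !mulgA -[e * f * f]mulgA ff -[_ * e * e]mulgA ee.
  - rewrite !mulgA -[f * x * e * e]mulgA ee -[_ * f * f]mulgA ff.
    by rewrite -[in RHS]xax !mulgA.
have xx : x * x = x.
  by rewrite -{1 2}fxeE !mulgA -[in RHS]fxeE -{3}xax !mulgA.
have -> : e * f = x by apply: (inverse_uniq Sx); rewrite ?xx.
exact: xx.
Qed.

Lemma idempotentC e f :
  S e -> S f -> e * e = e -> f * f = f -> e * f = f * e.
Proof.
move=> Se Sf ee ff.
have ef := idempotent_mul Se Sf ee ff; have fe := idempotent_mul Sf Se ff ee.
have Sef := Clifford_mul Se Sf.
(* Both products are inverses of [e * f]. *)
apply: (inverse_uniq Sef) => //; rewrite ?ef //; first exact: Clifford_mul.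
- by rewrite !mulgA -[e * f * f]mulgA ff -[_ * e * e]mulgA ee -mulgA ef.
- by rewrite !mulgA -[f * e * e]mulgA ee -[_ * f * f]mulgA ff -mulgA fe.
Qed.

(** With [b] the group inverse of [a], the inverse [b * e] of [e * a] must
    commute with it; this is where complete regularity is essential, as
    idempotents of inverse semigroups need not be central. *)
Lemma idempotent_central e a : S e -> e * e = e -> S a -> e * a = a * e.
Proof.
move=> Se ee Sa.
have [u au] := group_unit_exists Sa.
have eu : e * u = u * e.
  by apply: idempotentC; [|apply: group_unit_in au| |apply: group_unit_idem au].
have ru := group_unitr au.
case: (au) => b Sb [ab ba ua ub].
have Sea := Clifford_mul Se Sa; have Sbe := Clifford_mul Sb Se.
have [v [c Sc [eac cea v_ea v_c]]] := group_unit_exists Sea.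
have eabe : e * a * (b * e) = e * u.
  by rewrite !mulgA -[e * a * b]mulgA ab -mulgA -eu mulgA ee.
have bu : b * u = b by rewrite -ab mulgA ba.
have beE : b * e = c.
  apply: (inverse_uniq Sea) => //; rewrite ?eac ?cea //.
  - by rewrite eabe !mulgA -[e * u * e]mulgA -eu mulgA ee -mulgA ua.
  - by rewrite -mulgA eabe mulgA -[b * e * e]mulgA ee -mulgA eu mulgA bu.
have bea : b * e * a = e * u.
  by rewrite -eabe beE eac -cea -beE !mulgA -[b * e * e]mulgA ee.
rewrite -[in RHS]ru -[RHS]mulgA -eu -bea !mulgA ab -eu -mulgA.
by rewrite ua.
Qed.

Lemma group_unit_mul a b e f : S a -> S b ->
  group_unit a e -> group_unit b f -> group_unit (a * b) (e * f).
Proof.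
move=> Sa Sb ae bf.
have Se := group_unit_in Sa ae; have Sf := group_unit_in Sb bf.
have centre_e := idempotent_central Se (group_unit_idem ae).
have centre_f := idempotent_central Sf (group_unit_idem bf).
case: ae bf => a' Sa' [aa a'a ea ea'] [b' Sb' [bb b'b fb fb']].
exists (b' * a'); first exact: Clifford_mul.
split.
- by rewrite !mulgA -[a * b * b']mulgA bb -(centre_f a) // -mulgA aa centre_f.
- by rewrite !mulgA -[b' * a' * a]mulgA a'a -(centre_e b') // -mulgA b'b.
- by rewrite mulgA -[e * f * a]mulgA centre_f // mulgA ea -mulgA fb.
- by rewrite centre_e // !mulgA -[f * e * b']mulgA centre_e // mulgA fb'
    -mulgA ea'.
Qed.

Lemma maximal_subgroup e : S e -> e * e = e ->
  subgroup [set a | S a /\ group_unit a e].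
Proof.
move=> Se ee; split.
  move=> a b [Sa ae] [Sb be]; split; first exact: Clifford_mul.
  by rewrite -ee; apply: group_unit_mul.
exists e; first by split=> //; apply: group_unit_idempotent.
split=> [a [Sa ae]|a [Sa [b Sb [ab ba ea eb]]]].
  by case: (ae) => b _ [_ _ -> _]; rewrite (group_unitr ae).
by exists b => //; split=> //; exists a.
Qed.

(** * The retraction of a strict extension *)

Definition acts_like (A a : X) :=
  S a /\ forall s, S s -> A * s = a * s /\ s * A = s * a.

Lemma acts_like_refl a : S a -> acts_like a a. Proof. by []. Qed.

(** Weak reductivity: testing on the group units [e] of [a] and [f] of [b]
    gives [a = b * e] and [b = a * f], and [e], [f] commute. *)
Lemma acts_like_uniq A a b : acts_like A a -> acts_like A b -> a = b.
Proof.
move=> [Sa Aa] [Sb Ab].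
have [e ae] := group_unit_exists Sa; have [f bf] := group_unit_exists Sb.
have Se := group_unit_in Sa ae; have Sf := group_unit_in Sb bf.
have be : b * e = a by rewrite -(Ab e Se).1 (Aa e Se).1 (group_unitr ae).
have af : a * f = b by rewrite -(Aa f Sf).1 (Ab f Sf).1 (group_unitr bf).
rewrite -be -{1}af -mulgA -(idempotent_central Se (group_unit_idem ae) Sf).
by rewrite mulgA (group_unitr ae) af.
Qed.

Lemma acts_like_exists A : strict_extension S -> exists a, acts_like A a.
Proof.
case=> _ strict; have [SA|/strict [a Sa Aa]] := pselect (S A); last by exists a.
by exists A; apply: acts_like_refl.
Qed.

Lemma acts_like_mul A B a b : ideal S ->
  acts_like A a -> acts_like B b -> acts_like (A * B) (a * b).
Proof.
move=> idS [Sa Aa] [Sb Bb]; split; first exact: Clifford_mul.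
move=> s Ss; split.
  by rewrite -!mulgA (Bb s Ss).1 (Aa (b * s) (Clifford_mul Sb Ss)).1.
by rewrite !mulgA (Aa s Ss).2 (Bb (s * a) (Clifford_mul Ss Sa)).2.
Qed.

End Clifford.

Theorem corollary4p4 (Sigma : semigroupType) (S : set Sigma)
    (hS : Clifford S) (hSigma : strict_stratified_extension S) :
  semilattice_of Sigma (@stratified_extension_of_group Sigma).
Proof.
case: hSigma => strictS BaseS; have idS := strictS.1.
have /choice [p pE] : forall A, exists e,
    exists2 a, acts_like S A a & group_unit S a e.
  move=> A; have [a Aa] := acts_like_exists A strictS.
  by have [e ae] := group_unit_exists hS Aa.1; exists e, a.
have p_eq A a e : acts_like S A a -> group_unit S a e -> p A = e.
  move=> Aa ae; have [b Ab bp] := pE A; rewrite (acts_like_uniq hS Ab Aa) in bp.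
  exact: (group_unit_uniq hS Aa.1 bp ae).
have p_eqS a e : S a -> group_unit S a e -> p a = e.
  by move=> Sa; apply: p_eq; apply: acts_like_refl.
have Sp A : S (p A) by have [a [Sa _] ae] := pE A; apply: group_unit_in ae.
have p_idem A : p A * p A = p A.
  by have [a _ ae] := pE A; apply: group_unit_idem ae.
apply: (@semilattice_of_endomorphism _ _ p) => //.
- move=> A B; have [a Aa ae] := pE A; have [b Bb bf] := pE B.
  apply: p_eq (acts_like_mul hS idS Aa Bb) _.
  exact: (group_unit_mul hS Aa.1 Bb.1 ae bf).
- by move=> A; apply: p_eqS => //; apply: group_unit_idempotent.
- by move=> A B; apply: (idempotentC hS).
move=> A; rewrite /stratified_extension_of_group.
set F := [set B | _]; pose H := [set a | S a /\ group_unit S a (p A)].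
suff -> : Base F = H by apply: maximal_subgroup.
rewrite eqEsubset; split=> [a BFa|].
  have Sa : S a by rewrite -BaseS; apply: BaseSS BFa.
  split=> //; have [e ae] := group_unit_exists hS Sa.
  by rewrite -(Base_sub BFa : p a = p A) (p_eqS _ _ Sa ae).
have sHF : H `<=` F by move=> a [Sa ae]; apply: p_eqS.
apply: subset_trans (BaseSS sHF); apply: sub_Base => a [Sa ae].
exists (p A); first by split=> //; apply: group_unit_idempotent.
by exists a => //; case: ae => b _ [_ _ ? _].
Qed.
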